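(* Let $p$ be a prime and let $i\geq 0$. If $p$ is odd, then $O(c_i)\geq (1+2p)(1+2p^2)\cdots (1+2p^{i+1})$. If $p=2$ and $i\geq 5$, then $O(c_i)\geq N_1N_2N_3N_4 (1+2^7)(1+2^8)\cdots (1+2^{i+2})$.
   Context: Fix a prime $p$ and an algebraic closure $E$ of $\mathbb{F}_p$. Put $c_{-1}=1$ and, recursively for $i\geq -1$, let $c_{i+1}\in E$ be any chosen root of $X^p-X-(c_{-1}c_0\cdots c_i)^{p-1}$. All $c_i$ are nonzero. For $i\geq 0$ put $N_i=\dfrac{p^{p^{i+1}}-1}{p^{p^i}-1}$. For $x\in E^\times$, $O(x)$ denotes the multiplicative order of $x$. *)

(* Defs.v *)
From HB Require Import structures.
From mathcomp Require Import all_boot all_order all_algebra.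

Set Implicit Arguments.
Unset Strict Implicit.
Unset Printing Implicit Defensive.

Import GRing.Theory.
Local Open Scope ring_scope.

(* Indices are shifted by one: [c 0] is c_{-1} and [c i.+1] is c_i. *)
Definition as_tower (p : nat) (E : fieldType) (c : nat -> E) : Prop :=
  c 0%N = 1 /\
  forall i : nat,
    root ('X^p - 'X - ((\prod_(j < i.+1) c j) ^+ (p - 1))%:P) (c i.+1).

(* For [1 < p] the division is exact. *)
Definition tower_norm (p i : nat) : nat :=
  ((p ^ (p ^ i.+1) - 1) %/ (p ^ (p ^ i) - 1))%N.

(* Main.v *)
(* The tower lives in the fields F_{q_k}, q_k = p^(p^k), with c_k in F_{q_{k+1}}
   but not in F_{q_k}, and the relative norm of c_k, which is its power of exponent
   N_k, is (c_{-1} ... c_{k-1})^(p-1).  If the order of c_i were prime to N_j,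
   j <= i, then descending through these norm relations (which only extracts roots
   of exponents p - 1 and N_k + p - 1 = 2p - 1 mod N_j, all prime to N_j) the same
   would hold for c_j, whose order divides N_j (q_j - 1); then c_j^(q_j - 1) = 1,
   contradicting that c_j is not in F_{q_j}.  So the order shares with each of the
   pairwise coprime N_j a divisor greater than 1.  Prime divisors of N_j are 1 mod
   p^(j+1), which bounds that divisor from below; for p = 2 the N_j are Fermat
   numbers, whose prime divisors are even 1 mod 2^(j+2) and the first five of which
   are prime. *)
Require Import Defs.
From HB Require Import structures.
From mathcomp Require Import all_boot all_order all_algebra.
From mathcomp Require Import finfield zify.

Local Open Scope ring_scope.
Import GRing.Theory.

(** * Arithmetic of the N_k: congruences and pairwise coprimality *)

Lemma subn1_expn_factor (p k : nat) : (1 < p)%N ->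
  (p ^ (p ^ k.+1) - 1 = (p ^ (p ^ k) - 1) * \sum_(l < p) (p ^ (p ^ k)) ^ l)%N.
Proof. by move=> p_gt1; rewrite expnSr expnM !subn1 predn_exp. Qed.

Lemma subn1_expn_gt0 (p k : nat) : (1 < p)%N -> (0 < p ^ (p ^ k) - 1)%N.
Proof.
by move=> p_gt1; rewrite subn_gt0 -(exp1n (p ^ k)) ltn_exp2r ?expn_gt0 // ltnW.
Qed.

Lemma tower_normE (p k : nat) : (1 < p)%N ->
  tower_norm p k = (\sum_(l < p) (p ^ (p ^ k)) ^ l)%N.
Proof.
by move=> p_gt1; rewrite /tower_norm subn1_expn_factor // mulKn ?subn1_expn_gt0.
Qed.

Lemma tower_normM (p k : nat) : (1 < p)%N ->
  (p ^ (p ^ k.+1) - 1 = (p ^ (p ^ k) - 1) * tower_norm p k)%N.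
Proof. by move=> p_gt1; rewrite tower_normE ?subn1_expn_factor. Qed.

Lemma tower_norm_modn (p k d : nat) : (1 < p)%N ->
  (d %| p ^ (p ^ k) - 1)%N -> tower_norm p k = p %[mod d].
Proof.
move=> p_gt1 d_dvd; rewrite tower_normE // -modn_summ.
have q_mod : p ^ (p ^ k) = 1 %[mod d].
  by apply/eqP; rewrite eqn_mod_dvd ?expn_gt0 ?(ltnW p_gt1).
under eq_bigr => l _ do rewrite -modnXm q_mod modnXm exp1n.
by rewrite modn_summ sum1_card card_ord.
Qed.

Lemma subn1_expn_dvdn (p j k : nat) : (1 < p)%N -> (j <= k)%N ->
  (p ^ (p ^ j) - 1 %| p ^ (p ^ k) - 1)%N.
Proof.
move=> p_gt1 /subnK <-; elim: (k - j)%N => // m IHm.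
by rewrite addSn tower_normM // dvdn_mulr.
Qed.

Lemma tower_norm_dvdn (p j k : nat) : (1 < p)%N -> (j < k)%N ->
  (tower_norm p j %| p ^ (p ^ k) - 1)%N.
Proof.
move=> p_gt1 j_lt_k; apply: dvdn_trans (subn1_expn_dvdn _ _ _ p_gt1 j_lt_k).
by rewrite tower_normM // dvdn_mull.
Qed.

(** N_k is p modulo q_k - 1, and q_k - 1 is prime to p. *)
Lemma coprime_tower_norm_pred (p k : nat) : prime p ->
  coprime (p ^ (p ^ k) - 1) (tower_norm p k).
Proof.
move=> p_prime; have p_gt1 := prime_gt1 p_prime.
rewrite /coprime -gcdn_modr tower_norm_modn // gcdn_modr gcdnC -/(coprime _ _).
rewrite prime_coprime // dvdn_subr ?dvdn1 ?gtn_eqF ?expn_gt0 ?prime_gt0 //.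
by rewrite dvdn_exp // expn_gt0 prime_gt0.
Qed.

Lemma coprime_tower_norm (p j k : nat) : prime p -> (j < k)%N ->
  coprime (tower_norm p j) (tower_norm p k).
Proof.
move=> p_prime j_lt_k.
apply: coprime_dvdl (coprime_tower_norm_pred p k p_prime).
exact: tower_norm_dvdn (prime_gt1 _) _.
Qed.

Lemma coprime_pred_tower_norm (p k : nat) : prime p ->
  coprime (p - 1) (tower_norm p k).
Proof.
move=> p_prime; apply: coprime_dvdl (coprime_tower_norm_pred p k p_prime).
by have := subn1_expn_dvdn p 0 k (prime_gt1 p_prime) (leq0n k); rewrite expn0 expn1.
Qed.

(** * Size of the divisors of N_k *)

(** The hypotheses force the order of [z] to be exactly [l ^ m.+1], and Fermat's little theorem
    makes it divide [r - 1]. *)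
Lemma Fp_order_dvdn (l m r : nat) (z : 'F_r) : prime l -> prime r ->
  z ^+ (l ^ m.+1) = 1 -> z ^+ (l ^ m) != 1 -> (l ^ m.+1 %| r - 1)%N.
Proof.
move=> l_prime r_prime z1 zN1.
have [|n n_prim] := prim_order_exists _ z1; first by rewrite expn_gt0 prime_gt0.
case/(dvdn_pfactor _ _ l_prime) => k k_le n_def.
have k_eq : k = m.+1.
  apply/eqP; rewrite eqn_leq k_le ltnNge; apply: contra zN1 => k_le_m.
  by rewrite -(prim_order_dvd n_prim) n_def dvdn_exp2l.
have z_neq0 : z != 0.
  apply: contra_eq_neq z1 => ->.
  by rewrite expr0n expn_eq0 eqn0Ngt prime_gt0 // eq_sym oner_eq0.
rewrite -k_eq -n_def (prim_order_dvd n_prim) subn1.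
apply/eqP/(mulfI z_neq0); rewrite -exprS prednK ?prime_gt0 // mulr1.
by rewrite -[X in _ ^+ X](card_Fp r_prime) expf_card.
Qed.

Lemma Fp_natr_expn_eq1 (r b e : nat) : prime r -> (0 < b)%N ->
  ((b%:R : 'F_r) ^+ e == 1) = (r %| b ^ e - 1)%N.
Proof.
move=> r_prime b_gt0; rewrite -natrX (dvdn_pcharf (pchar_Fp r_prime)).
by rewrite natrB ?expn_gt0 ?b_gt0 // subr_eq0.
Qed.

(** Modulo [r] the order of [p] is exactly [p ^ k.+1]: [r] divides q_{k+1} - 1, but not q_k - 1,
    which is prime to N_k. *)
Lemma prime_dvd_tower_norm (p k r : nat) : prime p -> prime r ->
  (r %| tower_norm p k)%N -> (p ^ k.+1 %| r - 1)%N.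
Proof.
move=> p_prime r_prime r_dvd; have p_gt1 := prime_gt1 p_prime.
apply: (Fp_order_dvdn _ _ _ (p%:R : 'F_r)) => //.
  apply/eqP.
  by rewrite Fp_natr_expn_eq1 ?prime_gt0 // (dvdn_trans r_dvd) ?tower_norm_dvdn.
rewrite Fp_natr_expn_eq1 ?prime_gt0 //; apply/negP => r_dvd'.
have := coprime_tower_norm_pred p k p_prime.
move/(coprime_dvdl r_dvd')/(coprime_dvdr r_dvd).
by rewrite prime_coprime // dvdnn.
Qed.

Lemma tower_norm2E (k : nat) : tower_norm 2 k = (2 ^ (2 ^ k) + 1)%N.
Proof. by rewrite tower_normE // !big_ord_recl big_ord0 addn0 addnC. Qed.

(* 2 is the square of x + x^-1 = x - x^3, where x = 2^(2^k) has order 8 modulo r. *)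
Lemma prime_dvd_Fermat (k r : nat) : prime r ->
  (r %| 2 ^ (2 ^ k.+2) + 1)%N -> (2 ^ k.+4 %| r - 1)%N.
Proof.
move=> r_prime; rewrite (dvdn_pcharf (pchar_Fp r_prime)) natrD natrX.
set x : 'F_r := 2%:R ^+ (2 ^ k).
have -> : (2%:R : 'F_r) ^+ (2 ^ k.+2) = x ^+ 4 by rewrite -exprM !expnSr -mulnA.
rewrite addr_eq0 => /eqP x4.
have xV : x * - x ^+ 3 = 1 by rewrite mulrN -exprS x4 opprK.
have s2 : (x - x ^+ 3) ^+ 2 = 2%:R.
  rewrite sqrrD sqrrN mulrN -exprS x4 -[in X in _ + X]exprM (exprD x 4 2) x4.
  by rewrite mulN1r opprK addrC addKr.
(* In characteristic 2, [x] would vanish, although [xV] makes it invertible. *)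
have r_neq2 : (1 : 'F_r) != -1.
  apply/negP => /eqP eq1.
  have x0 : x = 0.
    apply/eqP; rewrite expf_eq0 expn_gt0 /=.
    by rewrite (natrD _ 1 1) {2}eq1 addrN.
  by have := xV; rewrite x0 mul0r => /eqP; rewrite eq_sym oner_eq0.
(* Since the base squares to 2, its powers of exponents 2^(k+4) and 2^(k+3) are x^8 = 1 and x^4 =
   -1. *)
apply: (Fp_order_dvdn 2 k.+3 r (x - x ^+ 3)) => //; rewrite expnS exprM s2.
  rewrite !expnSr -!mulnA exprM -/x (_ : 2 * (2 * 2) = 4 * 2)%N //.
  by rewrite exprM x4 sqrrN expr1n.
by rewrite !expnSr -!mulnA exprM -/x x4 eq_sym.
Qed.

(** The least prime factor r of [d] is odd, so r - 1 is divisible by 2 as well as by the odd number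
    [p ^ k.+1]. *)
Lemma dvdn_tower_norm_odd (p k d : nat) : prime p -> odd p -> (1 < d)%N ->
  (d %| tower_norm p k)%N -> (1 + 2 * p ^ k.+1 <= d)%N.
Proof.
move=> p_prime p_odd d_gt1 d_dvd.
have r_prime := pdiv_prime d_gt1.
have pk_dvd := prime_dvd_tower_norm _ _ _ p_prime r_prime (dvdn_trans (pdiv_dvd d) d_dvd).
apply: leq_trans (pdiv_leq (ltnW d_gt1)).
rewrite -leq_subRL ?prime_gt0 // dvdn_leq ?subn_gt0 ?prime_gt1 //.
rewrite Gauss_dvd ?pk_dvd ?coprimeXr ?coprime2n // andbT dvdn2.
have pk_le := dvdn_leq _ pk_dvd; rewrite subn_gt0 prime_gt1 // in pk_le.
rewrite oddB ?prime_gt0 //=; case: (even_prime r_prime) => [r2|->//].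
have : (1 < p ^ k.+1)%N by rewrite -(exp1n k.+1) ltn_exp2r ?prime_gt1.
by have := pk_le isT; lia.
Qed.

Lemma dvdn_tower_norm_2 (k d : nat) : (1 < d)%N ->
  (d %| tower_norm 2 k.+2)%N -> (1 + 2 ^ k.+4 <= d)%N.
Proof.
move=> d_gt1; rewrite tower_norm2E => d_dvd.
have r_prime := pdiv_prime d_gt1.
have := prime_dvd_Fermat _ _ r_prime (dvdn_trans (pdiv_dvd d) d_dvd).
move/(dvdn_leq _); rewrite subn_gt0 prime_gt1 // => /(_ isT).
rewrite leq_subRL ?prime_gt0 // => /leq_trans; apply.
exact: pdiv_leq (ltnW d_gt1).
Qed.

Lemma prime_tower_norm2 (k : nat) : (k < 5)%N -> prime (tower_norm 2 k).
Proof. by rewrite tower_norm2E; do 5?case: k => [|k] //; vm_compute. Qed.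

(** A common prime factor is at most 2p - 1, but also exceeds p^(k+1), or even 2p^(k+1) for odd p.
    In the excluded case p = 2, k = 0 both numbers are 3. *)
Lemma coprime_tower_norm_2p1 (p k : nat) : prime p -> odd p || (0 < k)%N ->
  coprime (2 * p - 1) (tower_norm p k).
Proof.
move=> p_prime pk; rewrite /coprime eqn_leq gcdn_gt0 subn_gt0.
rewrite (leq_trans (prime_gt1 p_prime)) ?leq_pmull // andbT leqNgt; apply/negP => g_gt1.
have r_prime := pdiv_prime g_gt1; set r := pdiv _ in r_prime.
have r_dvdl : (r %| 2 * p - 1)%N := dvdn_trans (pdiv_dvd _) (dvdn_gcdl _ _).
have r_dvdr : (r %| tower_norm p k)%N := dvdn_trans (pdiv_dvd _) (dvdn_gcdr _ _).
have pk_dvd := prime_dvd_tower_norm _ _ _ p_prime r_prime r_dvdr.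
have r_gt1 := prime_gt1 r_prime; have p_gt1 := prime_gt1 p_prime.
have r_le : (r <= 2 * p - 1)%N by apply: dvdn_leq r_dvdl; lia.
case/orP: pk => [p_odd | k_gt0].
  have := dvdn_tower_norm_odd _ _ _ p_prime p_odd r_gt1 r_dvdr.
  have : (p <= p ^ k.+1)%N by rewrite expnS leq_pmulr // expn_gt0 ltnW.
  lia.
have : (p ^ k.+1 <= r - 1)%N by apply: dvdn_leq pk_dvd; lia.
have : (p ^ 2 <= p ^ k.+1)%N by rewrite leq_exp2l.
rewrite expnS expn1; nia.
Qed.

(** * Products and power sums over translates by the prime field *)

Lemma rmorph_Fp_roots_prod (p : nat) (F : fieldType) (iota : {rmorphism 'F_p -> F})
    (x : F) :
  prime p -> \prod_(u : 'F_p) (x + iota u) = x ^+ p - x.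
Proof.
move=> p_prime.
have /(congr1 (fun f => (map_poly iota f).[x])) := finField_genPoly 'F_p.
rewrite (card_Fp p_prime) rmorphB /= map_polyXn map_polyX !hornerE => ->.
rewrite rmorph_prod horner_prod (reindex_inj oppr_inj) /=.
by apply: eq_bigr => u _; rewrite rmorphB /= map_polyX map_polyC !hornerE /= rmorphN.
Qed.

(* Plus one, the sum is a polynomial in x of degree less than p that vanishes on F_p. *)
Lemma rmorph_Fp_power_sum (p : nat) (F : fieldType) (iota : {rmorphism 'F_p -> F})
    (x : F) :
  prime p -> \sum_(u : 'F_p) (x + iota u) ^+ (p - 1) = -1.
Proof.
move=> p_prime.
pose S : {poly F} := \sum_(u : 'F_p) ('X - (iota u)%:P) ^+ (p - 1) + 1.
have SE y : S.[y] = \sum_(u : 'F_p) (y + iota u) ^+ (p - 1) + 1.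
  rewrite hornerD horner_sum hornerC (reindex_inj oppr_inj); congr (_ + 1).
  by apply: eq_bigr => u _; rewrite !hornerE /= rmorphN opprK.
suff S0 : S = 0 by apply/eqP; rewrite -addr_eq0 -SE S0 horner0.
apply/eqP; apply: contraT => S_neq0.
have roots : all (root S) [seq iota u | u <- enum 'F_p].
  apply/allP => _ /mapP[a _ ->]; rewrite rootE SE (reindex_inj (addIr (- a))) /=.
  under eq_bigr => u _ do rewrite -rmorphD addrC subrK -rmorphXn.
  (* The term u = 0 vanishes because p - 1 > 0, and the others are 1 by Fermat, so the total is (p -
     1) + 1 = 0. *)
  rewrite -(rmorph1 iota) -rmorph_sum -rmorphD fmorph_eq0 (bigD1 0) //=.
  rewrite expr0n subn_eq0 leqNgt prime_gt1 // add0r.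
  rewrite (eq_bigr (fun=> 1)) => [|u u_neq0]; last first.
    apply: (mulfI u_neq0); rewrite -exprS subn1 prednK ?prime_gt0 // mulr1.
    by rewrite -[X in _ ^+ X](card_Fp p_prime) expf_card.
  rewrite (eq_bigl (mem (predC1 0))) // sumr_const cardC1 card_Fp // -mulrSr.
  by rewrite prednK ?prime_gt0 // pchar_Fp_0.
have := max_poly_roots S_neq0 roots.
rewrite map_inj_uniq ?enum_uniq; last exact: fmorph_inj.
rewrite size_map -cardT card_Fp // => /(_ isT); rewrite ltnNge => /negP[].
rewrite (leq_trans (size_polyD _ _)) // geq_max size_poly1 prime_gt0 // andbT.
apply: (leq_trans (size_sum _ _ _)); apply/bigmax_leqP => u _.
by rewrite size_exp_XsubC subn1 prednK ?prime_gt0.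
Qed.

Lemma big_Fp (p : nat) (R : Type) (idx : R) (op : Monoid.law idx)
    (f : nat -> R) : prime p ->
  \big[op/idx]_(l < p) f l = \big[op/idx]_(u : 'F_p) f u.
Proof.
by move=> p_prime; rewrite -(big_mkord xpredT) -[in LHS](Fp_cast p_prime) big_mkord.
Qed.

(** Dividing by [t] turns a progression of difference [t] into translates by the prime field. *)
Lemma arith_progression_scale (p : nat) (F : fieldType) (iota : {rmorphism 'F_p -> F})
    (x t : F) (u : 'F_p) :
  t != 0 -> x + (u : nat)%:R * t = t * (x / t + iota u).
Proof.
move=> t_neq0; rewrite mulrDr [t * (x / t)]mulrC divfK // [t * iota u]mulrC.
by rewrite -[in RHS](natr_Zp u) rmorph_nat.
Qed.

Lemma arith_progression_prod (p : nat) (F : fieldType) (iota : {rmorphism 'F_p -> F})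
    (x t : F) :
  prime p -> t ^+ p = t -> t != 0 -> \prod_(l < p) (x + l%:R * t) = x ^+ p - x.
Proof.
move=> p_prime tp t_neq0; pose f l := x + l%:R * t.
rewrite -/(\prod_(l < p) f l) (big_Fp _ _ _ _ f) //.
under eq_bigr => u _ do rewrite /f (arith_progression_scale p F iota) //.
rewrite big_split /= prodr_const card_Fp // rmorph_Fp_roots_prod // mulrBr -exprMn.
by rewrite tp mulrC divfK.
Qed.

Lemma arith_progression_power_sum (p : nat) (F : fieldType)
    (iota : {rmorphism 'F_p -> F}) (x t : F) :
  prime p -> t ^+ p = t -> t != 0 -> \sum_(l < p) (x + l%:R * t) ^+ (p - 1) = -1.
Proof.
move=> p_prime tp t_neq0; pose f l := (x + l%:R * t) ^+ (p - 1).
have t1 : t ^+ (p - 1) = 1.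
  by apply: (mulfI t_neq0); rewrite -exprS subn1 prednK ?prime_gt0 // mulr1.
rewrite -/(\sum_(l < p) f l) (big_Fp _ _ _ _ f) //.
rewrite -(rmorph_Fp_power_sum p F iota (x / t)) //; apply: eq_bigr => u _; rewrite /f.
by rewrite (arith_progression_scale p F iota) // exprMn t1 mul1r.
Qed.

(** * Frobenius powers and Artin-Schreier roots *)

Lemma expr_Frobenius_fix (F : fieldType) (p m n : nat) (x : F) :
  x ^+ (p ^ m) = x -> x ^+ (p ^ (m * n)) = x.
Proof.
move=> x_fix; elim: n => [|n IHn]; first by rewrite muln0 expr1.
by rewrite mulnS expnD exprM x_fix.
Qed.

Lemma Frobenius_fix_le (F : fieldType) (p j k : nat) (x : F) : (j <= k)%N ->
  x ^+ (p ^ (p ^ j)) = x -> x ^+ (p ^ (p ^ k)) = x.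
Proof.
by move=> /subnKC <- x_fix; rewrite expnD expr_Frobenius_fix.
Qed.

Lemma pnat_pchar_expn (F : fieldType) (p m : nat) : p \in [pchar F] ->
  [pchar F].-nat (p ^ m)%N.
Proof.
by move=> p_char; rewrite pnatX pnatE ?p_char // (pcharf_prime p_char).
Qed.

Lemma exprD_Frobenius (F : fieldType) (p m : nat) (x y : F) : p \in [pchar F] ->
  (x + y) ^+ (p ^ m) = x ^+ (p ^ m) + y ^+ (p ^ m).
Proof. by move=> p_char; rewrite exprDn_pchar ?pnat_pchar_expn. Qed.

(** * The tower: fields of definition and relative norms *)

Definition tower_prod {F : fieldType} (c : nat -> F) (k : nat) : F :=
  \prod_(j < k.+1) c j.

Lemma tower_step (p : nat) (E : fieldType) (c : nat -> E) (k : nat) : as_tower p c ->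
  c k.+1 ^+ p = c k.+1 + tower_prod c k ^+ (p - 1).
Proof.
case=> _ /(_ k); rewrite /root !hornerE subr_eq0 subr_eq addrC.
by move=> /eqP->.
Qed.

(** The q_k-Frobenius fixes [b], so it sends [y] to another root of X^p - X - b. Two roots differ by
    a [t] with t^p = t; Frobenius fixes this [t], so each iteration adds it once more. *)
Lemma Artin_Schreier_conj (p k : nat) (F : fieldType) (y b : F) :
  p \in [pchar F] -> b ^+ (p ^ (p ^ k)) = b -> y ^+ p = y + b ->
  let t := y ^+ (p ^ (p ^ k)) - y in
  t ^+ p = t /\ forall l, y ^+ ((p ^ (p ^ k)) ^ l) = y + l%:R * t.
Proof.
move=> p_char b_fix yp t; have FrobD m := exprD_Frobenius F p m _ _ p_char.
have qE : y ^+ (p ^ (p ^ k)) = y + t by rewrite addrC subrK.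
have tp : t ^+ p = t.
  apply: (addrI (y + b)); rewrite -{1}yp -[X in _ ^+ X + _ ^+ X]expn1 -FrobD -qE.
  by rewrite expn1 exprAC yp FrobD b_fix qE addrAC.
have t_fix m : t ^+ (p ^ m) = t.
  by rewrite -[m]mul1n expr_Frobenius_fix ?expn1.
split=> //; elim=> [|l IHl]; first by rewrite mul0r addr0 expr1.
rewrite expnSr exprM IHl FrobD qE -addrA mulrSr mulrDl mul1r [t + _]addrC.
have l_fix m : l%:R ^+ (p ^ m) = l%:R :> F.
  rewrite -[m]mul1n expr_Frobenius_fix // expn1.
  by rewrite -(pFrobenius_autE p_char) pFrobenius_aut_nat.
by rewrite exprMn t_fix l_fix.
Qed.

Lemma tower_fix (p : nat) (E : fieldType) (c : nat -> E) (k j : nat) :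
  p \in [pchar E] -> as_tower p c -> (j <= k)%N -> c j ^+ (p ^ (p ^ k)) = c j.
Proof.
move=> p_char c_tower; have p_gt0 := prime_gt0 (pcharf_prime p_char).
elim: k j => [|k IHk] j.
  by rewrite leqn0 => /eqP->; case: c_tower => -> _; rewrite expr1n.
rewrite leq_eqVlt ltnS => /orP[/eqP->|/IHk]; last exact: Frobenius_fix_le.
have b_fix : (tower_prod c k ^+ (p - 1)) ^+ (p ^ (p ^ k)) = tower_prod c k ^+ (p - 1).
  rewrite exprAC -prodrXl; congr (_ ^+ _); apply: eq_bigr => l _.
  by rewrite IHk // -ltnS.
have [_ conj] := Artin_Schreier_conj _ _ _ _ _ p_char b_fix (tower_step _ _ _ _ c_tower).
(* The p-th iterate of the q_k-Frobenius translates by p t = 0. *)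
by rewrite expnSr expnM conj (pcharf0 p_char) mul0r addr0.
Qed.

Lemma tower_prod_fix (p : nat) (E : fieldType) (c : nat -> E) (k m : nat) :
  p \in [pchar E] -> as_tower p c ->
  (tower_prod c k ^+ m) ^+ (p ^ (p ^ k)) = tower_prod c k ^+ m.
Proof.
move=> p_char c_tower; rewrite exprAC -prodrXl; congr (_ ^+ _); apply: eq_bigr => l _.
by rewrite (tower_fix p) // -ltnS.
Qed.

(* Up to sign, the relative trace of a solution at level k.+1 is a solution at level k. *)
Lemma tower_no_solution (p : nat) (E : fieldType) (iota : {rmorphism 'F_p -> E})
    (c : nat -> E) (k : nat) (y : E) :
  prime p -> as_tower p c -> y ^+ (p ^ (p ^ k)) = y ->
  y ^+ p != y + tower_prod c k ^+ (p - 1).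
Proof.
move=> p_prime c_tower; have p_char := rmorph_pchar iota (pchar_Fp p_prime).
have FrobD m := exprD_Frobenius E p m _ _ p_char.
have Frob_sum m (I : finType) (f : I -> E) :
    (\sum_i f i) ^+ (p ^ m) = \sum_i f i ^+ (p ^ m).
  elim/big_rec2: _ => [|i a b _ <-]; last exact: FrobD.
  by rewrite expr0n expn_eq0 eqn0Ngt prime_gt0.
elim: k y => [|k IHk] y y_fix.
  (* At the bottom y^p = y, so the equation would read 0 = 1. *)
  rewrite /tower_prod big_ord_recl big_ord0; case: c_tower => -> _.
  rewrite expn0 expn1 in y_fix; rewrite y_fix mulr1 expr1n.
  by rewrite -subr_eq0 opprD addrA addrN add0r oppr_eq0 oner_eq0.
apply/eqP => yp.
set q := (p ^ (p ^ k))%N; pose w := \sum_(l < p) y ^+ (q ^ l).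
have b_fix := tower_prod_fix p E c k (p - 1) p_char c_tower.
have [tp conj] := Artin_Schreier_conj _ _ _ _ _ p_char b_fix (tower_step _ _ _ _ c_tower).
set t := _ - _ in tp conj.
(* The induction hypothesis applied to [c k.+1] itself shows that Frobenius moves it. *)
have t_neq0 : t != 0.
  apply/negP; rewrite subr_eq0 => /eqP c_fix.
  by have := IHk _ c_fix; rewrite (tower_step _ _ _ _ c_tower) eqxx.
have w_fix : w ^+ q = w.
  rewrite Frob_sum /w.
  under eq_bigr => l _ do rewrite -exprM -expnSr.
  apply/eqP; rewrite -subr_eq0 -sumrB.
  rewrite -(big_mkord xpredT (fun l => y ^+ (q ^ l.+1) - y ^+ (q ^ l))).
  by rewrite (telescope_sumr (fun l => y ^+ (q ^ l))) // -expnM -expnSr y_fix subrr.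
have wp : w ^+ p = w - tower_prod c k ^+ (p - 1).
  (* Frobenius moves only the last factor of the product, along a progression of difference [t]; the
     power sum -1 then gives the trace of the constant term. *)
  have bE l : (tower_prod c k.+1 ^+ (p - 1)) ^+ (q ^ l) =
      tower_prod c k ^+ (p - 1) * (c k.+1 + l%:R * t) ^+ (p - 1).
    rewrite /tower_prod big_ord_recr /= -/(tower_prod c k) exprMn exprMn.
    by rewrite /q -expnM expr_Frobenius_fix // expnM exprAC conj.
  rewrite -[X in _ ^+ X](expn1 p) Frob_sum expn1.
  under eq_bigr => l _ do rewrite exprAC yp /q -expnM FrobD expnM bE.
  rewrite big_split /= -mulr_sumr -/w.
  by rewrite (arith_progression_power_sum _ _ iota) // mulrN1.
have := IHk (- w); rewrite (exprNn_pchar _ (pnat_pchar_expn _ p _ p_char)) w_fix.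
rewrite (exprNn_pchar _ (pnat_pchar_expn _ p 1 p_char)) expn1 wp.
by rewrite opprB addrC eqxx => /(_ erefl).
Qed.

Lemma tower_not_fix (p : nat) (E : fieldType) (iota : {rmorphism 'F_p -> E})
    (c : nat -> E) (k : nat) :
  prime p -> as_tower p c -> c k.+1 ^+ (p ^ (p ^ k)) != c k.+1.
Proof.
move=> p_prime c_tower; apply/eqP => c_fix.
have := tower_no_solution _ _ iota _ _ _ p_prime c_tower c_fix.
by rewrite (tower_step _ _ _ _ c_tower) eqxx.
Qed.

(** The left side is the product of the conjugates y + l t of y = [c k.+1]; as t is nonzero, this is
    y^p - y. *)
Lemma tower_norm_expr (p : nat) (E : fieldType) (iota : {rmorphism 'F_p -> E})
    (c : nat -> E) (k : nat) :
  prime p -> as_tower p c ->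
  c k.+1 ^+ tower_norm p k = tower_prod c k ^+ (p - 1).
Proof.
move=> p_prime c_tower; have p_char := rmorph_pchar iota (pchar_Fp p_prime).
have b_fix := tower_prod_fix p E c k (p - 1) p_char c_tower.
have yp := tower_step _ _ _ k c_tower.
have [tp conj] := Artin_Schreier_conj _ _ _ _ _ p_char b_fix yp.
rewrite tower_normE ?prime_gt1 // expr_sum.
under eq_bigr => l _ do rewrite conj.
rewrite (arith_progression_prod _ _ iota) ?subr_eq0 ?tower_not_fix //.
by rewrite yp addrC addKr.
Qed.

Lemma tower_neq0 (p : nat) (E : fieldType) (c : nat -> E) (k : nat) :
  prime p -> as_tower p c -> c k != 0.
Proof.
move=> p_prime c_tower; have p1 : (0 < p - 1)%N by rewrite subn_gt0 prime_gt1.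
elim/ltn_ind: k => -[|k] IHk; first by case: c_tower => -> _; rewrite oner_eq0.
apply/eqP => ck0; have := tower_step _ _ _ k c_tower.
rewrite ck0 add0r expr0n eqn0Ngt prime_gt0 // => /esym/eqP.
rewrite expf_eq0 p1 /= prodf_seq_eq0 => /hasP[l _ /=].
by rewrite (negbTE (IHk _ (ltn_ord l))).
Qed.

(** * Torsion of order prime to N_j and its descent along the tower *)

(** For [N] > 1 this says that [x] has finite order prime to [N]. Any annihilating exponent will do,
    so that roots and quotients need no computation of exact orders. *)
Definition coprime_torsion {F : fieldType} (N : nat) (x : F) : Prop :=
  exists2 e, coprime e N & x ^+ e = 1.

Lemma coprime_torsion_root (F : fieldType) (N s : nat) (x : F) :
  coprime s N -> coprime_torsion N (x ^+ s) -> coprime_torsion N x.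
Proof.
move=> sN [e eN x1]; exists (s * e)%N; first by rewrite coprimeMl sN.
by rewrite exprM.
Qed.

Lemma coprime_torsion_exp (F : fieldType) (N s : nat) (x : F) :
  coprime_torsion N x -> coprime_torsion N (x ^+ s).
Proof. by case=> e eN x1; exists e => //; rewrite exprAC x1 expr1n. Qed.

Lemma coprime_torsion_mulKl (F : fieldType) (N : nat) (x y : F) :
  coprime_torsion N x -> coprime_torsion N (x * y) -> coprime_torsion N y.
Proof.
move=> [e eN x1] [f fN xy1]; exists (e * f)%N; first by rewrite coprimeMl eN.
have : (x * y) ^+ (e * f) = 1 by rewrite mulnC exprM xy1 expr1n.
by rewrite exprMn exprM x1 expr1n mul1r.
Qed.

(** The product is a nonzero element of F_{q_k}, and q_k - 1 is prime to N_k. *)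
Lemma tower_prod_torsion (p : nat) (E : fieldType) (c : nat -> E) (k : nat) :
  p \in [pchar E] -> as_tower p c ->
  coprime_torsion (tower_norm p k) (tower_prod c k).
Proof.
move=> p_char c_tower; have p_prime := pcharf_prime p_char.
exists (p ^ (p ^ k) - 1)%N; first exact: coprime_tower_norm_pred.
have a_neq0 : tower_prod c k != 0.
  by apply/prodf_neq0 => l _; exact: tower_neq0 p_prime c_tower.
apply: (mulfI a_neq0); rewrite -exprS subn1 prednK ?expn_gt0 ?prime_gt0 // mulr1.
by have := tower_prod_fix p E c k 1 p_char c_tower; rewrite !expr1.
Qed.

Lemma coprime_tower_norm_addp (p j k : nat) : prime p -> odd p || (0 < j)%N ->
  (j < k)%N -> coprime (tower_norm p k + (p - 1)) (tower_norm p j).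
Proof.
move=> p_prime pj j_lt_k; have p_gt1 := prime_gt1 p_prime.
rewrite coprime_sym /coprime -gcdn_modr -modnDml.
rewrite (tower_norm_modn p k) ?tower_norm_dvdn // modnDml gcdn_modr.
have -> : (p + (p - 1) = 2 * p - 1)%N by lia.
by rewrite -/(coprime _ _) coprime_sym coprime_tower_norm_2p1.
Qed.

Lemma tower_not_torsion (p : nat) (E : fieldType) (iota : {rmorphism 'F_p -> E})
    (c : nat -> E) (j i : nat) :
  prime p -> as_tower p c -> odd p || (0 < j)%N -> (j <= i)%N ->
  ~ coprime_torsion (tower_norm p j) (c i.+1).
Proof.
move=> p_prime c_tower pj; have p_char := rmorph_pchar iota (pchar_Fp p_prime).
have p_gt1 := prime_gt1 p_prime.
(* The power of exponent q_j - 1 has order dividing both N_j and [e], hence is 1, which would put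
   [c j.+1] in F_{q_j}. *)
have base : ~ coprime_torsion (tower_norm p j) (c j.+1).
  case=> e eN c1; have c_neq0 := tower_neq0 p E c j.+1 p_prime c_tower.
  have /eqP[] := tower_not_fix _ _ iota _ j p_prime c_tower.
  have yN : (c j.+1 ^+ (p ^ (p ^ j) - 1)) ^+ tower_norm p j = 1.
    rewrite -exprM -tower_normM //; apply: (mulfI c_neq0).
    rewrite -exprS subn1 prednK ?expn_gt0 ?prime_gt0 // mulr1.
    exact: tower_fix p_char c_tower _.
  have ye : (c j.+1 ^+ (p ^ (p ^ j) - 1)) ^+ e = 1 by rewrite exprAC c1 expr1n.
  have N_gt0 : (0 < tower_norm p j)%N.
    have := subn1_expn_gt0 p j.+1 p_gt1.
    by rewrite tower_normM // muln_gt0 => /andP[].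
  have [n n_prim n_dvd] := prim_order_exists N_gt0 yN.
  have n_dvd' : (n %| e)%N by rewrite (prim_order_dvd n_prim) ye.
  have := coprime_dvdl n_dvd' (coprime_dvdr n_dvd eN).
  rewrite /coprime gcdnn => /eqP n1; move: (prim_expr_order n_prim).
  rewrite n1 expr1 subn1 => y1.
  by rewrite -[(p ^ (p ^ j))%N]prednK ?expn_gt0 ?prime_gt0 // exprSr y1 mul1r.
(* Induction runs over the products. At m = j + 1 the factor [tower_prod c j] is itself torsion
   prime to N_j and cancels, leaving [c j.+1]. *)
have prod_base m : (j < m)%N -> ~ coprime_torsion (tower_norm p j) (tower_prod c m).
  elim: m => // m IHm; rewrite ltnS leq_eqVlt => /orP[/eqP <-|j_lt_m] a_tors.
    apply: base.
    apply: coprime_torsion_mulKl (tower_prod_torsion p E c j p_char c_tower) _.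
    by move: a_tors; rewrite /tower_prod big_ord_recr.
  apply: (IHm j_lt_m).
  (* With a = [tower_prod c m], raising a * [c m.+1] to the power N_m gives a^(N_m + p - 1), whose
     exponent is prime to N_j. *)
  have /(coprime_torsion_exp _ _ (tower_norm p m)) := a_tors.
  rewrite {1}/tower_prod big_ord_recr /= -/(tower_prod c m) exprMn.
  rewrite (tower_norm_expr _ _ iota) // -exprD.
  by apply: coprime_torsion_root; apply: coprime_tower_norm_addp.
rewrite leq_eqVlt => /orP[/eqP <- //|j_lt_i] c_tors.
apply: (prod_base _ j_lt_i); apply: (coprime_torsion_root _ _ (p - 1)).
  exact: coprime_pred_tower_norm.
by rewrite -(tower_norm_expr _ _ iota) //; apply: coprime_torsion_exp.
Qed.

(** * Assembling the lower bound for the order *)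

(** The gcds inherit pairwise coprimality from the N_k, so these divisors of [n] multiply to a
    divisor. *)
Lemma prod_gcdn_tower_norm (p n j i : nat) : prime p ->
  (\prod_(j <= k < i) gcdn n (tower_norm p k) %| n)%N.
Proof.
move=> p_prime; have [i_le_j|] := leqP i j; first by rewrite big_geq ?dvd1n.
elim: i => // i IHi; rewrite ltnS => j_le_i.
have IH : (\prod_(j <= k < i) gcdn n (tower_norm p k) %| n)%N.
  by move: j_le_i; rewrite leq_eqVlt => /orP[/eqP->|/IHi //]; rewrite big_geq.
rewrite big_nat_recr //= Gauss_dvd ?IH ?dvdn_gcdl //.
rewrite big_nat;
  apply: (big_ind (fun m => coprime m _)) => [|a b aN bN|k /andP[_ k_lt_i]].
- exact: coprime1n.
- by rewrite coprimeMl aN.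
apply: coprime_dvdl (dvdn_gcdr _ _) (coprime_dvdr (dvdn_gcdr _ _) _).
exact: coprime_tower_norm.
Qed.

Lemma gcdn_tower_norm_gt1 (p : nat) (E : fieldType) (iota : {rmorphism 'F_p -> E})
    (c : nat -> E) (j i n : nat) :
  prime p -> as_tower p c -> odd p || (0 < j)%N -> (j <= i)%N ->
  n.-primitive_root (c i.+1) -> (1 < gcdn n (tower_norm p j))%N.
Proof.
move=> p_prime c_tower pj j_le_i n_prim.
rewrite ltn_neqAle gcdn_gt0 (prim_order_gt0 n_prim) andbT eq_sym; apply/negP => cop.
apply: (tower_not_torsion _ _ iota _ _ _ p_prime c_tower pj j_le_i).
by exists n => //; apply: prim_expr_order.
Qed.

Theorem corollary4p9 (p : nat) (p_prime : prime p)
    (E : closedFieldType) (iota : {rmorphism 'F_p -> E})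
    (E_algebraic : forall x : E, algebraicOver iota x)
    (c : nat -> E) (c_tower : as_tower p c) (i : nat) :
  (odd p ->
    exists2 n : nat, n.-primitive_root (c i.+1)
      & (\prod_(1 <= k < i.+2) (1 + 2 * p ^ k) <= n)%N) /\
  (p = 2%N -> (5 <= i)%N ->
    exists2 n : nat, n.-primitive_root (c i.+1)
      & (tower_norm p 1 * tower_norm p 2 * tower_norm p 3 * tower_norm p 4
         * \prod_(7 <= k < i.+3) (1 + 2 ^ k) <= n)%N).
Proof.
have p_gt1 := prime_gt1 p_prime.
have p_char := rmorph_pchar iota (pchar_Fp p_prime).
have c1 : c i.+1 ^+ (p ^ (p ^ i.+1) - 1) = 1.
  apply: (mulfI (tower_neq0 p E c i.+1 p_prime c_tower)).
  rewrite -exprS subn1 prednK ?expn_gt0 ?prime_gt0 // mulr1.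
  exact: tower_fix p_char c_tower _.
have [n n_prim _] := prim_order_exists (subn1_expn_gt0 p i.+1 p_gt1) c1.
have n_gt0 := prim_order_gt0 n_prim.
have gcd_gt1 j : odd p || (0 < j)%N -> (j <= i)%N -> (1 < gcdn n (tower_norm p j))%N.
  by move=> pj j_le_i; apply: (gcdn_tower_norm_gt1 _ _ iota) n_prim.
have prod_le j := dvdn_leq n_gt0 (prod_gcdn_tower_norm p n j i.+1 p_prime).
split=> [p_odd|p2 i_ge5]; exists n => //.
  (* The factor of index k in the bound comes from N_{k-1}. *)
  apply: leq_trans (prod_le 0%N); rewrite big_add1 /= big_nat [leqRHS]big_nat.
  apply: leq_prod => j /andP[_ j_le_i].
  by apply: dvdn_tower_norm_odd (dvdn_gcdr _ _); rewrite ?gcd_gt1 ?p_odd.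
(* These N_j are prime, so a gcd greater than 1 is all of N_j. *)
have gcd_full j : (0 < j < 5)%N -> gcdn n (tower_norm p j) = tower_norm p j.
  case/andP=> j_gt0 j_lt5; have := gcd_gt1 j; rewrite j_gt0 orbT => /(_ isT).
  move/(_ (ltnW (leq_trans j_lt5 i_ge5))).
  have N_prime : prime (tower_norm p j) by rewrite p2 prime_tower_norm2.
  have /primeP[_ /(_ _ (dvdn_gcdr n _))] := N_prime.
  by case/orP=> /eqP-> //; rewrite ltnn.
(* For p = 2 the product starts at N_1, as the descent does not cover N_0 = 3. The factors N_1 to
   N_4 are kept whole; for 5 <= j <= i the gcd with N_j is at least 1 + 2^(j+2), whence the range
   from 7 to i + 2. *)
apply: leq_trans (prod_le 1%N).
rewrite [leqRHS](@big_cat_nat _ _ _ 5) //=; last exact: leqW.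
rewrite 4?[in leqRHS]big_ltn // [in leqRHS]big_geq // muln1 !mulnA.
rewrite !gcd_full // leq_mul2l 2!big_add1 /= big_nat [leqRHS]big_nat.
apply/orP; right; apply: leq_prod => -[|[|j]] // /andP[_ j_le_i].
rewrite p2; apply: dvdn_tower_norm_2 (dvdn_gcdr _ _).
by have := gcd_gt1 j.+2 (orbT _) j_le_i; rewrite p2.
Qed.
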